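(* Let $\kappa\in(0,1]$. For $\mathcal X_n=(X_n,d^{X_n},\mu_{X_n})$, $n\in\mathbb N$, and $\mathcal X=(X,d^X,\mu_X)$ in $\mathfrak K(\tau)$, the following conditions are equivalent to each other. (i) There exist a compact metric space $(M,d^M)$ and isometric embeddings $f_n:X_n\to M$, $f:X\to M$ such that $f_n(X_n)\to f(X)$ in the Hausdorff topology, and $\mu_{X_n}\circ f_n^{-1}\to\mu_X\circ f^{-1}$ weakly. (ii) $d^{\tau,\mathrm{BL}^\kappa}_{\mathfrak K}(\mathcal X_n,\mathcal X)\to0$. In particular, $d^{\tau,\mathrm{BL}^\kappa}_{\mathfrak K}$ induces the compact Gromov-Hausdorff-Prokhorov topology.
   Context: A measured compact metric space is $(X,d^X,\mu_X)$ with $(X,d^X)$ a (non-empty) compact metric space and $\mu_X$ a Radon (hence finite) Borel measure on $X$. Two such are equivalent if there is an isometry from one onto the other pushing the first measure to the second. $\mathfrak K(\tau)$ is a set of measured compact metric spaces containing exactly one representative of each equivalence class. For a compact metric space $(Z,d^Z)$: $d^Z_{\mathrm H}$ is the Hausdorff distance between compact subsets; $\|f\|_{\mathrm{BL}^\kappa(Z)}=\sup_Z|f|+\sup_{x\ne y}|f(x)-f(y)|/d^Z(x,y)^\kappa$; for finite Radon measures, $d^Z_{\mathrm{BL}^\kappa}(\mu,\nu)=\sup\{|\int f\,d(\mu-\nu)|:\|f\|_{\mathrm{BL}^\kappa(Z)}\le1\}$; $d^Z_P$ is the Prokhorov distance. $d^{\tau,\mathrm{BL}^\kappa}_{\mathfrak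 K}(\mathcal X,\mathcal Y)=\inf_{f,g,Z}\{d^Z_{\mathrm H}(f(X),g(Y))\vee d^Z_{\mathrm{BL}^\kappa}(\mu_X\circ f^{-1},\mu_Y\circ g^{-1})\}$, the infimum over all compact metric spaces $(Z,d^Z)$ and isometric embeddings $f:X\to Z$, $g:Y\to Z$. The compact Gromov-Hausdorff-Prokhorov topology is the topology on $\mathfrak K(\tau)$ induced by the metric defined in the same way with $d^Z_P$ in place of $d^Z_{\mathrm{BL}^\kappa}$. *)

(* Defs.v *)
From HB Require Import structures.
From mathcomp Require Import all_boot all_order all_algebra.
From mathcomp Require Import all_classical all_reals all_analysis.

Set Implicit Arguments.
Unset Strict Implicit.
Unset Printing Implicit Defensive.

Import Order.TTheory GRing.Theory Num.Theory.
Import numFieldNormedType.Exports.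

Local Open Scope classical_set_scope.
Local Open Scope ring_scope.

HB.mixin Record isCompactSpace T & Topological T := {
  compactT : compact [set: T]
}.

(* Nonemptiness is carried by [Pointed], which the library requires of every
   measurable space; nothing below depends on the chosen point. *)
#[short(type="compactMetricType")]
HB.structure Definition CompactMetric (R : numDomainType) :=
  { T of Pointed T & Metric R T & isCompactSpace T }.

Definition borel (T : topologicalType) := g_sigma_algebraType (@open T).

HB.instance Definition _ (R : realType) (X : compactMetricType R) :=
  Measurable.copy (borel X) (g_sigma_algebraType (@open X)).

Notation borel_measure X R := {measure set (borel X) -> \bar R}.

(* Finite on compact sets and inner regular. *)
Definition radon (R : realType) (X : compactMetricType R)
    (mu : borel_measure X R) :=
  (forall C : set X, compact C -> (mu C < +oo)%E) /\
  (forall A : set (borel X), measurable A ->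
     mu A = ereal_sup [set mu C | C in [set C : set X | compact C /\ C `<=` A]]).

Record mcms (R : realType) := MCMS {
  mcms_space :> compactMetricType R ;
  mcms_measure : borel_measure mcms_space R ;
  mcms_radon : radon mcms_measure
}.

Record isometric_embedding (R : realType) (X Z : compactMetricType R) :=
  IsometricEmbedding {
    emb_fun :> X -> Z ;
    emb_isometric : forall x y : X, mdist (emb_fun x) (emb_fun y) = mdist x y
  }.

Section image_measure.
Context (R : realType) (X Z : compactMetricType R).

Lemma emb_continuous (f : isometric_embedding X Z) : continuous f.
Proof.
move=> x; apply/(@metricType_numDomainType.cvgrPdist_lt _ Z) => e e0.
have /= := @metricType_numDomainType.cvgr_dist_lt _ X X (nbhs x)
  (nbhs_filter x) id x (@cvg_id _ (nbhs x)) e e0.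
by apply: filterS => y; rewrite emb_isometric.
Qed.

Lemma emb_measurable (f : isometric_embedding X Z) :
  measurable_fun [set: borel X] (f : borel X -> borel Z).
Proof.
apply: (@measurability _ _ (borel X) (borel Z) setT f (@open Z)) => //.
move=> _ [B oB <-]; rewrite setTI; apply: sub_sigma_algebra.
by move/continuousP : (@emb_continuous f); exact.
Qed.

Definition image_measure (mu : borel_measure X R)
    (f : isometric_embedding X Z) : set (borel Z) -> \bar R :=
  pushforward mu (f : borel X -> borel Z).

HB.instance Definition _ (mu : borel_measure X R)
    (f : isometric_embedding X Z) :=
  Measure.copy (image_measure mu f)
    (measure_function_pushforward__canonical__measure_function_Measure
       mu (emb_measurable f)).

End image_measure.

Section distances.
Context (R : realType) (Z : compactMetricType R).
Implicit Types (A B : set Z) (e : R) (mu nu : borel_measure Z R).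

Definition enlarge A e : set Z := \bigcup_(a in A) ball a e.

Definition hausdorff_dist A B : \bar R :=
  ereal_inf [set e%:E | e in [set e | [/\ 0 < e,
    A `<=` enlarge B e & B `<=` enlarge A e]]].

(* The maximum with 0 only matters when Z is a single point, where the
   supremum over pairs of distinct points is that of the empty set. *)
Definition BL_norm (kappa : R) (f : Z -> R) : \bar R :=
  (ereal_sup [set `|f z|%:E | z in [set: Z]] +
   maxe 0 (ereal_sup [set r | exists x y : Z, x <> y /\
     r = (`|f x - f y| / mdist x y `^ kappa)%:E]))%E.

Definition BL_dist (kappa : R) mu nu : \bar R :=
  ereal_sup [set `|\int[mu]_z f z - \int[nu]_z f z|%:E |
    f in [set f : Z -> R | (BL_norm kappa f <= 1)%E]].

Definition prokhorov_dist mu nu : \bar R :=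
  ereal_inf [set e%:E | e in [set e | 0 < e /\
    forall A : set (borel Z), measurable A ->
      (mu A <= nu (enlarge A e) + e%:E)%E /\
      (nu A <= mu (enlarge A e) + e%:E)%E]].

Definition weak_cvg (mu_ : nat -> borel_measure Z R) mu :=
  forall h : Z -> R, continuous h -> [bounded h z | z in [set: Z]] ->
    \int[mu_ n]_z h z @[n --> \oo] --> \int[mu]_z h z.

End distances.

Section measured_compact_metric_spaces.
Context (R : realType).

Definition mcms_equiv (X Y : mcms R) :=
  exists f : isometric_embedding X Y, range f = [set: Y] /\
    forall A : set (borel Y), measurable A ->
      image_measure (mcms_measure X) f A = mcms_measure Y A.

(* Collections of spaces are plain predicates: [set (mcms R)] would force the
   universe of [compactMetricType] strictly below that of [pointedType]. *)
Definition is_representative_set (K : mcms R -> Prop) :=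
  forall X : mcms R, exists! Y : mcms R, K Y /\ mcms_equiv X Y.

Lemma mcms_equiv_refl X : mcms_equiv X X.
Proof.
exists (@IsometricEmbedding _ X X id (fun _ _ => erefl)).
by split=> //; rewrite image_id.
Qed.

Lemma mcms_equiv_trans X Y Z :
  mcms_equiv X Y -> mcms_equiv Y Z -> mcms_equiv X Z.
Proof.
move=> [f [fT fmu]] [g [gT gmu]].
have gf_isom (x y : X) : mdist ((g \o f) x) ((g \o f) y) = mdist x y.
  by rewrite /= !emb_isometric.
exists (IsometricEmbedding gf_isom); split.
  apply/seteqP; split=> // z _.
  have [y _ <-] : range g z by rewrite gT.
  have [x _ <-] : range f y by rewrite fT.
  by exists x.
move=> A mA; rewrite -gmu// /image_measure /pushforward -fmu//.
by rewrite -[X in measurable X]setTI; exact: emb_measurable.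
Qed.

Lemma mcms_equiv_sym X Y : mcms_equiv X Y -> mcms_equiv Y X.
Proof.
move=> [f [fT fmu]].
have finv y : exists x : X, f x = y.
  by have [x _ <-] : range f y by [rewrite fT]; exists x.
have [g fgK] := choice finv.
have g_isom (x y : Y) : mdist (g x) (g y) = mdist x y.
  by rewrite -(emb_isometric f) !fgK.
have gfK x : g (f x) = x.
  by apply: mdist_positivity; rewrite -(emb_isometric f) fgK mdistxx.
exists (IsometricEmbedding g_isom); split.
  by apply/seteqP; split=> // x _; exists (f x).
move=> A mA; rewrite /image_measure /pushforward -fmu; last first.
  rewrite -[X in measurable X]setTI.
  exact: (emb_measurable (IsometricEmbedding g_isom)).
rewrite /image_measure /pushforward; congr (mcms_measure X _).
by apply/seteqP; split=> x /=; rewrite gfK.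
Qed.

Lemma representative_set_exists : exists K, is_representative_set K.
Proof.
pose pick (S : mcms R -> Prop) (S0 : exists Y, S Y) := sval (cid S0).
have pickE S S' S0 S0' : S = S' -> @pick S S0 = @pick S' S0'.
  move=> SS'; case: _ / SS' S0' => S0'.
  by congr (pick S _); exact: Prop_irrelevance.
pose canon X := @pick (mcms_equiv X) (ex_intro _ X (mcms_equiv_refl X)).
have canonP X : mcms_equiv X (canon X) by rewrite /canon /pick; case: cid.
have canonE X Y : mcms_equiv X Y -> canon X = canon Y.
  move=> XY; apply: pickE; apply/funext => Z; apply/propext.
  by split; apply: mcms_equiv_trans => //; exact: mcms_equiv_sym.
exists (fun Y => exists X, canon X = Y) => X; exists (canon X); split.
  by split; [exists X|exact: canonP].
move=> _ [[Y <-] XY]; apply: canonE.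
exact: mcms_equiv_trans XY (mcms_equiv_sym (canonP Y)).
Qed.

Definition embedding_dist
    (delta : forall Z : compactMetricType R,
       borel_measure Z R -> borel_measure Z R -> \bar R)
    (X Y : mcms R) : \bar R :=
  ereal_inf [set r | exists (Z : compactMetricType R)
      (f : isometric_embedding X Z) (g : isometric_embedding Y Z),
    r = maxe (hausdorff_dist (range f) (range g))
          (delta Z (image_measure (mcms_measure X) f)
                   (image_measure (mcms_measure Y) g))].

Definition dist_BL (kappa : R) : mcms R -> mcms R -> \bar R :=
  embedding_dist (fun Z => @BL_dist R Z kappa).

Definition dist_GHP : mcms R -> mcms R -> \bar R :=
  embedding_dist (@prokhorov_dist R).

(* The open subsets of K for the topology whose neighbourhoods are given by
   the d-balls. *)
Definition induced_topology (K : mcms R -> Prop)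
    (d : mcms R -> mcms R -> \bar R) : (mcms R -> Prop) -> Prop :=
  fun U => (forall X, U X -> K X) /\
    forall X, U X -> exists e : R, 0 < e /\
      forall Y, K Y -> (d X Y < e%:E)%E -> U Y.

Definition embedded_cvg (X_ : nat -> mcms R) (X : mcms R) :=
  exists (M : compactMetricType R)
      (f_ : forall n, isometric_embedding (X_ n) M)
      (f : isometric_embedding X M),
    hausdorff_dist (range (f_ n)) (range f) @[n --> \oo] --> 0%E /\
    weak_cvg (fun n => image_measure (mcms_measure (X_ n)) (f_ n))
             (image_measure (mcms_measure X) f).

End measured_compact_metric_spaces.

(* Main.v *)
From HB Require Import structures.
Require Import Defs.
From mathcomp Require Import finmap.
From mathcomp Require Import all_boot all_order all_algebra.
From mathcomp Require Import all_classical all_reals all_analysis.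
From mathcomp Require Import measurable_realfun.
From mathcomp Require Import ring lra.
Set Implicit Arguments.
Unset Strict Implicit.
Unset Printing Implicit Defensive.
Import Order.TTheory GRing.Theory Num.Theory.
Import numFieldNormedType.Exports.
Local Open Scope classical_set_scope.
Local Open Scope ring_scope.

(** On a single compact space [Z] the Prokhorov distance and the distance
    [BL_dist] control each other with moduli that do not depend on [Z]: testing
    a small [BL_dist] on a Lipschitz bump around a set [A] bounds the mass of
    [A] by that of its enlargement ([prokhorov_close_BL]), and slicing a
    Hoelder function into superlevel sets turns a Prokhorov bound into a bound
    on its integrals ([BL_dist_le_prokhorov]); in this second direction the
    modulus involves the total mass of one of the two measures.  Both
    Gromov-type distances are infima over the same common embeddings, so every
    ball about a given space for one of them contains a ball about the same
    space for the other, and the two families of balls define the same open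
    sets.

    If all the spaces sit in one compact [M] and the measures converge weakly,
    then [BL_dist] tends to zero: all admissible test functions have the same
    modulus of continuity, so a partition of unity subordinate to a fine finite
    net reduces them, up to a uniform error, to finitely many continuous
    functions ([weak_cvg_BL_dist]).  The space [M] itself then witnesses that
    the Gromov-type distance tends to zero.

    Conversely, suppose that [X_ n] and [X] embed in [Z_n] with both distances
    below [s_n], where [s_n] tends to zero.  The space [M] is the disjoint union
    of [X] and all the [X_ n], where [X_ n] is attached to [X] at the distances
    read in [Z_n] and increased by [s_n], and where passing from one [X_ n] to
    another requires a detour through [X] ([glued]).  It is compact because an
    ultrafilter that contains no branch can be pushed onto [X]
    ([glued_compact]).  The measures live in different [Z_n], so a continuous
    [h] on [M] has to be transported: an inf-convolution of its restriction to
    [X] is a function on [Z_n], close to [h] on both embedded spaces, whose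
    bound and Lipschitz constant do not depend on [n]; it is thus an admissible
    test function up to a fixed factor ([BL_dist_transfer]). *)

(** * Continuous functions and finite Borel measures on a compact metric space *)

Section finite_borel_measures.
Context (R : realType) (Z : compactMetricType R).
Implicit Types (mu nu : borel_measure Z R) (f g : Z -> R).

Definition mass mu : R := fine (mu setT).

Lemma mass_ge0 mu : 0 <= mass mu.
Proof. exact: fine_ge0. Qed.

Lemma continuous_mdistP f : continuous f <->
  forall x e, 0 < e -> exists2 d, 0 < d &
    forall y, mdist x y < d -> `|f x - f y| < e.
Proof.
split=> [cf x e e0|H x].
  have /cvgrPdist_lt/(_ e e0)/(@metricType_numDomainType.nbhs_mdistP _ Z) := cf x.
  by move=> [d /= d0 dP]; exists d => // y; exact: dP.
apply/cvgrPdist_lt => e /(H x) [d d0 dP].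
by apply/(@metricType_numDomainType.nbhs_mdistP _ Z); exists d.
Qed.

Lemma mdist_lip_continuous f (L : R) :
  (forall x y, `|f x - f y| <= L * mdist x y) -> continuous f.
Proof.
move=> fL; apply/continuous_mdistP => x e e0.
have L0 : 0 < `|L| + 1 by rewrite ltr_wpDl.
exists (e / (`|L| + 1)); first exact: divr_gt0.
move=> y; rewrite ltr_pdivlMr// => xy; apply: le_lt_trans xy.
rewrite (le_trans (fL x y))// mulrC ler_wpM2l ?mdist_ge0//.
by rewrite (le_trans (ler_norm L))// lerDl.
Qed.

Lemma compact_space_bounded f : continuous f ->
  exists2 B, 0 < B & forall z, `|f z| <= B.
Proof.
move=> cf; have /compact_bounded[B [_ BP]] : compact (range f).
  apply: continuous_compact; last exact: compactT.
  exact: continuous_subspaceT.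
exists (`|B| + 1); first by rewrite ltr_wpDl.
move=> z; apply: BP; last by exists z.
by rewrite (le_lt_trans (ler_norm _))// ltrDl.
Qed.

Lemma continuous_bounded_fun f : continuous f -> [bounded f z | z in [set: Z]].
Proof.
move=> /compact_space_bounded[B B0 BP]; exists B; split; first exact: gtr0_real.
by move=> x Bx z _; apply: le_trans (BP z) (ltW _).
Qed.

(** Heine-Cantor.  Compactness enters as near-covering: a property that holds
    locally for all small radii holds on the whole space for some radius. *)
Lemma compact_space_uniformly_continuous f : continuous f ->
  forall e, 0 < e -> exists2 d, 0 < d &
    forall x y, mdist x y < d -> `|f x - f y| < e.
Proof.
move=> cf e e0; have /compact_near_coveringP := @compactT _ Z.
move=> /(_ R 0^'+ (fun d x => forall y, mdist x y < d -> `|f x - f y| < e) _).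
case=> [x _|d /= d0 dP].
  have e20 : 0 < e / 2 by lra.
  have [d d0 dP] := (continuous_mdistP f).1 cf x _ e20.
  have d20 : 0 < d / 2 by lra.
  exists (ball x (d / 2), [set r | r < d / 2]) => /=.
    split; first exact: nbhsx_ballx.
    exact: nbhs_right_lt.
  move=> [x' r] [/=]; rewrite ballEmdist /= => xx' rd y x'y.
  have := dP x'; have := dP y; have := metric_triangle x x' y.
  have := mdist_ge0 x' y.
  have := ler_distD (f x) (f x') (f y); rewrite (distrC (f x') (f x)).
  move=> h1 h2 h3 h4 h5.
  have : `|f x - f y| < e / 2 by apply: h4; lra.
  have : `|f x - f x'| < e / 2 by apply: h5; lra.
  lra.
exists (d / 2); first by lra.
move=> x y xy; apply: (dP (d / 2)) xy => //=.
- by rewrite sub0r normrN gtr0_norm; lra.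
- lra.
Qed.

Lemma continuous_borel_measurable f :
  continuous f -> measurable_fun [set: borel Z] (f : borel Z -> R).
Proof.
move=> /continuousP cf; apply: (measurability _ (RGenOpens.measurableE R)).
move=> _ [_ [a [b ->] <-]]; rewrite setTI; apply: sub_sigma_algebra.
by apply: cf; exact: interval_open.
Qed.

Lemma open_borel_measurable (U : set Z) : open U -> measurable (U : set (borel Z)).
Proof. by move=> oU; exact: sub_sigma_algebra. Qed.

Section finite.
Variable mu : borel_measure Z R.
Hypothesis mu_fin : (mu setT < +oo)%E.

Lemma massE : (mass mu)%:E = mu setT.
Proof. by rewrite fineK// ge0_fin_numE. Qed.

Lemma measure_fin_num (A : set (borel Z)) : measurable A -> mu A \is a fin_num.
Proof.
move=> mA; rewrite ge0_fin_numE//; apply: le_lt_trans mu_fin.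
by apply: le_measure; rewrite ?inE.
Qed.

Lemma continuous_integrable f : continuous f ->
  mu.-integrable setT (EFin \o (f : borel Z -> R)).
Proof.
move=> cf; apply: measurable_bounded_integrable => //.
  exact: continuous_borel_measurable.
exact: continuous_bounded_fun.
Qed.

(** The estimate through which uniform approximation of an integrand enters
    all the later comparisons. *)
Lemma Rintegral_dist f g c : continuous f -> continuous g ->
  (forall z, `|f z - g z| <= c) ->
  `|\int[mu]_z f z - \int[mu]_z g z| <= c * mass mu.
Proof.
move=> cf cg fg; have icf := continuous_integrable cf.
have icg := continuous_integrable cg.
rewrite -RintegralB//; apply: le_trans (le_normr_Rintegral _ _) _ => //.
  have cfg : continuous (fun z => f z - g z).
    by move=> z; apply: cvgB; [exact: cf|exact: cg].
  exact: continuous_integrable.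
rewrite -(Rintegral_cst mu measurableT); apply: le_Rintegral => //.
- have cfg : continuous (fun z => `|f z - g z|).
    by move=> z; apply: cvg_norm; apply: cvgB; [exact: cf|exact: cg].
  exact: continuous_integrable.
- by have := @continuous_integrable (cst c); apply; exact: cst_continuous.
Qed.

End finite.
End finite_borel_measures.

Lemma mcms_finite (R : realType) (X : mcms R) : (mcms_measure X setT < +oo)%E.
Proof. by have [+ _] := mcms_radon X; apply; exact: compactT. Qed.

Section image.
Context (R : realType) (X Z : compactMetricType R).
Variables (mu : borel_measure X R) (f : isometric_embedding X Z).

Lemma image_measure_setT : image_measure mu f setT = mu setT.
Proof. by rewrite /image_measure /pushforward preimage_setT. Qed.

Lemma mass_image : mass (image_measure mu f) = mass mu.
Proof. by congr fine; exact: image_measure_setT. Qed.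

Lemma continuous_comp_emb (h : Z -> R) : continuous h -> continuous (h \o f).
Proof.
by move=> ch x; apply: continuous_comp; [exact: emb_continuous|exact: ch].
Qed.

Lemma Rintegral_image (h : Z -> R) : (mu setT < +oo)%E -> continuous h ->
  \int[image_measure mu f]_z h z = \int[mu]_x h (f x).
Proof.
move=> mufin ch; rewrite /Rintegral; congr fine.
rewrite (integral_pushforward (emb_measurable f)) ?preimage_setT//.
  by apply/measurable_EFinP; exact: continuous_borel_measurable.
have H := continuous_integrable mufin (continuous_comp_emb ch).
exact H.
Qed.

End image.

(** * Testing the bounded Hoelder distance on Lipschitz functions *)

Section finite_measure_integrals.
Context (R : realType) (Z : compactMetricType R) (mu : borel_measure Z R).
Hypothesis mu_fin : (mu setT < +oo)%E.

Lemma Rintegral_sum (I : Type) (s : seq I) (f : I -> borel Z -> R) :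
  (forall i, mu.-integrable setT (EFin \o f i)) ->
  mu.-integrable setT (EFin \o (fun z => \sum_(i <- s) f i z)) /\
  \int[mu]_z (\sum_(i <- s) f i z) = \sum_(i <- s) \int[mu]_z f i z.
Proof.
move=> intf; elim: s => [|i s [IH1 IH2]].
  split.
    rewrite (_ : _ \o _ = cst 0%E); first exact: integrable0.
    by apply/funext => z /=; rewrite big_nil.
  under eq_Rintegral do rewrite big_nil.
  by rewrite big_nil Rintegral_cst// mul0r.
have E : (fun z => \sum_(j <- i :: s) f j z) = f i \+ (fun z => \sum_(j <- s) f j z).
  by apply/funext => z; rewrite big_cons.
split.
  by rewrite E; exact: (integrableD measurableT (intf i) IH1).
by under eq_Rintegral do rewrite big_cons; rewrite RintegralD// IH2 big_cons.
Qed.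

Lemma indic_integrable (A : set (borel Z)) : measurable A ->
  mu.-integrable setT (EFin \o \1_A).
Proof.
move=> mA; apply: measurable_bounded_integrable => //.
exists 1; split => // x x1 z _; rewrite /= indicE.
by case: (z \in A); rewrite ?normr1 ?normr0 ltW// (lt_trans _ x1).
Qed.

Lemma Rintegral_indic (A : set (borel Z)) : measurable A ->
  \int[mu]_z \1_A z = fine (mu A).
Proof. by move=> mA; rewrite /Rintegral integral_indic// setIT. Qed.

Lemma fine_le_measure (A B : set (borel Z)) : measurable A -> measurable B ->
  A `<=` B -> fine (mu A) <= fine (mu B).
Proof.
move=> mA mB AB; rewrite fine_le ?measure_fin_num//.
by apply: le_measure; rewrite ?inE.
Qed.

End finite_measure_integrals.

Section bounded_lipschitz.
Context (R : realType) (Z : compactMetricType R) (k : R).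
Hypothesis k01 : 0 < k <= 1.
Implicit Types (mu nu : borel_measure Z R) (f : Z -> R).

Let k_gt0 : 0 < k. Proof. by case/andP: k01. Qed.

(** The two suprema of the norm are nonnegative, so a sum at most 1 bounds both;
    the reverse estimate is [BL_norm_le]. *)
Lemma BL_norm_le1 f : (BL_norm k f <= 1)%E ->
  (forall z, `|f z| <= 1) /\ (forall x y, `|f x - f y| <= mdist x y `^ k).
Proof.
rewrite /BL_norm; set a := ereal_sup _; set b := maxe _ _ => ab.
have a0 : (0 <= a)%E.
  by apply: le_ereal_sup_tmp; exists `|f point|%:E; [exists point|rewrite lee_fin].
have b0 : (0 <= b)%E by rewrite /b le_max lexx.
split=> [z|x y].
  rewrite -lee_fin; apply: le_trans ab; rewrite -[leLHS]adde0 leeD//.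
  by apply: le_ereal_sup_tmp; exists `|f z|%:E => //; exists z.
have [->|xy] := pselect (x = y); first by rewrite subrr normr0 powR_ge0.
have dxy : 0 < mdist x y by rewrite mdist_gt0; exact/eqP.
rewrite -[leRHS]mul1r -ler_pdivrMr ?powR_gt0// -lee_fin.
apply: le_trans ab; rewrite -[leLHS]add0e leeD//.
rewrite /b le_max; apply/orP; right.
apply: le_ereal_sup_tmp; exists (`|f x - f y| / mdist x y `^ k)%:E => //.
by exists x, y.
Qed.

Lemma BL_norm_le f (B C : R) : 0 <= C -> (forall z, `|f z| <= B) ->
  (forall x y, `|f x - f y| <= C * mdist x y `^ k) ->
  (BL_norm k f <= (B + C)%:E)%E.
Proof.
move=> C0 fB fC; rewrite /BL_norm EFinD leeD//.
  by apply: ge_ereal_sup => _ [z _ <-]; rewrite lee_fin.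
rewrite ge_max lee_fin C0; apply: ge_ereal_sup => _ [x [y [xy ->]]].
rewrite lee_fin ler_pdivrMr ?powR_gt0// mdist_gt0; exact/eqP.
Qed.

Lemma hoelder_continuous f :
  (forall x y, `|f x - f y| <= mdist x y `^ k) -> continuous f.
Proof.
move=> fk; apply/continuous_mdistP => x e e0.
exists (e `^ k^-1); first exact: powR_gt0.
move=> y xy; apply: (le_lt_trans (fk x y)).
rewrite -[ltRHS]powRr1 1?ltW// -(mulVf (lt0r_neq0 k_gt0)) powRrM.
by apply: gt0_ltr_powR => //; rewrite nnegrE ?powR_ge0 ?mdist_ge0.
Qed.

(** At distance at most 1 the Lipschitz bound is the stronger one because
    [k <= 1]; at larger distances the sup bound suffices. *)
Lemma lipschitz_hoelder f (B L : R) : 0 <= B -> 0 <= L ->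
  (forall z, `|f z| <= B) -> (forall x y, `|f x - f y| <= L * mdist x y) ->
  forall x y, `|f x - f y| <= (B + B + L) * mdist x y `^ k.
Proof.
move=> B0 L0 fB fL x y; have [d1|d1] := lerP (mdist x y) 1.
  have dk : mdist x y <= mdist x y `^ k.
    have [->|d0] := eqVneq (mdist x y) 0; first exact: powR_ge0.
    rewrite -[leLHS]powRr1 ?mdist_ge0// ger_powR//.
      by rewrite lt_neqAle eq_sym d0 mdist_ge0.
    by case/andP: k01.
  apply: (le_trans (fL x y)); rewrite mulrDl -[leLHS]add0r lerD//.
    by rewrite mulr_ge0 ?powR_ge0// addr_ge0.
  exact: ler_wpM2l.
have : 1 <= mdist x y `^ k.
  rewrite (_ : 1 = 1 `^ k); last by rewrite powR1.
  by rewrite ge0_ler_powR ?nnegrE ?mdist_ge0 ?ltW.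
move=> dk; apply: (@le_trans _ _ (B + B + L)); last first.
  by rewrite ler_peMr// !addr_ge0.
apply: (le_trans (ler_normB _ _)).
by have := fB x; have := fB y; lra.
Qed.

Lemma BL_dist_test mu nu (c : R) f : (BL_dist k mu nu <= c%:E)%E ->
  (BL_norm k f <= 1)%E -> `|\int[mu]_z f z - \int[nu]_z f z| <= c.
Proof.
move=> munu f1; rewrite -lee_fin; apply: le_trans munu.
by apply: le_ereal_sup_tmp; eexists; [exists f|].
Qed.

(** Rescaling makes every bounded Lipschitz function admissible.  The factor
    depends on the function only through [B] and [L], hence can be shared by
    functions living on different spaces. *)
Lemma BL_dist_lipschitz mu nu (c B L : R) f :
  (mu setT < +oo)%E -> (nu setT < +oo)%E -> 0 < B -> 0 <= L ->
  (BL_dist k mu nu <= c%:E)%E ->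
  (forall z, `|f z| <= B) -> (forall x y, `|f x - f y| <= L * mdist x y) ->
  `|\int[mu]_z f z - \int[nu]_z f z| <= (3 * B + L) * c.
Proof.
move=> muf nuf B0 L0 munu fB fL.
have cf := mdist_lip_continuous fL.
have D0 : 0 < 3 * B + L by lra.
have fH := lipschitz_hoelder (ltW B0) L0 fB fL.
set D := _ + _ in D0 *.
have g1 : (BL_norm k (fun z => D^-1 * f z)%R <= 1)%E.
  have D1 : D^-1 * B + D^-1 * (B + B + L) = 1.
    have -> : D^-1 * B + D^-1 * (B + B + L) = D^-1 * D by rewrite /D; ring.
    by rewrite mulVf// lt0r_neq0.
  have Di : `|D^-1| = D^-1 by rewrite gtr0_norm// invr_gt0.
  have Di0 : 0 <= D^-1 by rewrite invr_ge0 ltW.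
  apply: (@le_trans _ _ (D^-1 * B + D^-1 * (B + B + L))%R%:E); last by rewrite D1.
  apply: BL_norm_le.
  - by rewrite mulr_ge0//; lra.
  - by move=> z; rewrite normrM Di ler_wpM2l.
  - by move=> x y; rewrite -mulrBr normrM Di -mulrA ler_wpM2l.
have := BL_dist_test munu g1.
rewrite !RintegralZl//; [|exact: continuous_integrable..].
rewrite -mulrBr normrM gtr0_norm ?invr_gt0// mulrC ler_pdivrMr//.
by rewrite mulrC.
Qed.

Lemma mass_BL_dist mu nu (c : R) :
  (BL_dist k mu nu <= c%:E)%E -> `|mass mu - mass nu| <= c.
Proof.
move=> /BL_dist_test/(_ (_ : (BL_norm k (cst 1%R) <= 1)%E)).
rewrite /= !Rintegral_cst// !mul1r; apply.
apply: (@le_trans _ _ (1 + 0)%R%:E); last by rewrite addr0.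
apply: BL_norm_le => //.
  by move=> z; rewrite normr1.
by move=> x y; rewrite subrr normr0 mul0r.
Qed.

End bounded_lipschitz.

Section truncated_inf_convolution.
Context (R : realType) (Z : compactMetricType R) (T : pointedType).
Variables (g : T -> Z) (w : T -> R) (B L d : R).
Hypothesis wB : forall t, `|w t| <= B.
Hypotheses (L0 : 0 <= L) (d0 : 0 <= d).

Let hill z t := w t + L * Num.min (mdist z (g t)) d.

(** An infimum of cones of slope [L] with apexes [(g t, w t)], each truncated at
    height [L * d] above its apex: the slope makes it [L]-Lipschitz, and the
    truncation bounds it independently of the diameter of [Z]. *)
Definition inf_conv z := inf (range (hill z)).

Let hill_ge z t : - B <= hill z t.
Proof.
have := wB t; rewrite ler_norml => /andP[+ _].
have : 0 <= L * Num.min (mdist z (g t)) d.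
  by rewrite mulr_ge0// le_min mdist_ge0.
rewrite /hill; lra.
Qed.

Lemma inf_conv_le z t : inf_conv z <= w t + L * Num.min (mdist z (g t)) d.
Proof. by apply: ge_inf; [exists (- B) => _ [s _ <-]|exists t]. Qed.

Lemma inf_conv_ge z c :
  (forall t, c <= w t + L * Num.min (mdist z (g t)) d) -> c <= inf_conv z.
Proof.
move=> H; apply: lb_le_inf; first by exists (hill z point), point.
by move=> _ [t _ <-]; exact: H.
Qed.

Lemma inf_conv_lipschitz x y : `|inf_conv x - inf_conv y| <= L * mdist x y.
Proof.
have H u v : inf_conv u - L * mdist u v <= inf_conv v.
  apply: inf_conv_ge => t; have := inf_conv_le u t.
  suff : L * Num.min (mdist u (g t)) d <=
         L * Num.min (mdist v (g t)) d + L * mdist u v by lra.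
  rewrite -mulrDr ler_wpM2l// addr_minl le_min !ge_min.
  have := metric_triangle u v (g t); have := mdist_ge0 u v.
  by move=> h1 h2; apply/andP; split; apply/orP; [left|right]; lra.
rewrite ler_norml; have := H x y; have := H y x; rewrite (metric_sym y x).
by move=> h1 h2; apply/andP; split; lra.
Qed.

Lemma inf_conv_bounded z : `|inf_conv z| <= B + L * d.
Proof.
have Ld : 0 <= L * d by rewrite mulr_ge0.
rewrite ler_norml; apply/andP; split.
  by apply: (@le_trans _ _ (- B)); [lra|apply: inf_conv_ge => t; exact: hill_ge].
apply: (le_trans (inf_conv_le z point)); rewrite lerD//.
  by rewrite (le_trans (ler_norm _)).
by rewrite ler_wpM2l// ge_min lexx orbT.
Qed.

End truncated_inf_convolution.

(** * Prokhorov distance against bounded Hoelder distance *)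

Section prokhorov.
Context (R : realType) (Z : compactMetricType R).
Implicit Types (mu nu : borel_measure Z R) (A B : set (borel Z)) (e : R).

Lemma open_enlarge (A : set Z) e : open (enlarge A e).
Proof.
rewrite openE => z [a Aa]; rewrite ballEmdist /= => az.
apply/nbhs_ballP; exists (e - mdist a z) => /=; first by rewrite subr_gt0.
move=> y; rewrite ballEmdist /= => zy; exists a => //; rewrite ballEmdist /=.
by have := metric_triangle a z y; lra.
Qed.

Lemma measurable_enlarge (A : set Z) e : measurable (enlarge A e : set (borel Z)).
Proof. by apply: open_borel_measurable; exact: open_enlarge. Qed.

Lemma enlargeT e : 0 < e -> enlarge [set: Z] e = setT.
Proof.
move=> e0; apply/seteqP; split=> // z _; exists z => //.
by rewrite ballEmdist /= mdistxx.
Qed.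

(** One half of the Prokhorov condition, in real numbers; being asymmetric, it
    lets each inequality be proved for one ordering of the measures only. *)
Definition prokhorov_close mu nu e := forall A, measurable A ->
  fine (mu A) <= fine (nu (enlarge A e)) + e.

Lemma prokhorov_dist_lt mu nu e : (mu setT < +oo)%E -> (nu setT < +oo)%E ->
  (prokhorov_dist mu nu < e%:E)%E ->
  exists2 d, 0 < d < e & prokhorov_close mu nu d /\ prokhorov_close nu mu d.
Proof.
move=> muf nuf /ereal_inf_lt [_ [d [d0 dP] <-]]; rewrite lte_fin => de.
exists d; first by rewrite d0.
split=> A mA; have [h1 h2] := dP A mA; have mAd := measurable_enlarge A d.
- rewrite -lee_fin EFinD !fineK//; exact: measure_fin_num.
- rewrite -lee_fin EFinD !fineK//; exact: measure_fin_num.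
Qed.

Lemma prokhorov_dist_le mu nu e : (mu setT < +oo)%E -> (nu setT < +oo)%E ->
  0 < e -> prokhorov_close mu nu e -> prokhorov_close nu mu e ->
  (prokhorov_dist mu nu <= e%:E)%E.
Proof.
move=> muf nuf e0 munu numu; apply: ereal_inf_lbound; exists e => //.
split=> // A mA; have mAe := measurable_enlarge A e; split.
- rewrite -[mu A]fineK ?measure_fin_num// -[nu _]fineK ?measure_fin_num//.
  by rewrite -EFinD lee_fin; exact: munu.
- rewrite -[nu A]fineK ?measure_fin_num// -[mu _]fineK ?measure_fin_num//.
  by rewrite -EFinD lee_fin; exact: numu.
Qed.

Lemma BL_distC k mu nu : BL_dist k mu nu = BL_dist k nu mu.
Proof.
by congr ereal_sup; apply/seteqP; split=> _ [f fk <-]; exists f => //; rewrite distrC.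
Qed.

(** A bump equal to 1 on [A], to 0 off the [e]-enlargement and
    [e^-1]-Lipschitz sits between the two indicator functions. *)
Lemma prokhorov_close_BL k mu nu e : 0 < k <= 1 ->
  (mu setT < +oo)%E -> (nu setT < +oo)%E -> 0 < e ->
  (BL_dist k mu nu <= (e / (3 + e^-1))%:E)%E -> prokhorov_close mu nu e.
Proof.
move=> k01 muf nuf e0 munu A mA.
have ei0 : 0 < e^-1 by rewrite invr_gt0.
(* Apexes at height 0 on [A] and 1 elsewhere: the inf-convolution vanishes on
   [A] and is 1 where no apex of [A] is within [e]. *)
pose w (x : Z) : R := 1 - \1_A x.
have w01 x : 0 <= w x <= 1.
  by rewrite /w indicE; case: (x \in A) => /=; apply/andP; split; lra.
have wB x : `|w x| <= 1 by case/andP: (w01 x) => w0 w1; rewrite ger0_norm.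
pose u := inf_conv id w e^-1 e.
pose phi z := 1 - u z.
have phi_lip x y : `|phi x - phi y| <= e^-1 * mdist x y.
  have := inf_conv_lipschitz id wB (ltW ei0) (ltW e0) x y.
  rewrite -/u distrC => h; suff -> : phi x - phi y = u y - u x by [].
  by rewrite /phi; ring.
have u0 z : 0 <= u z.
  apply: inf_conv_ge => x; case/andP: (w01 x) => w0 _.
  by rewrite addr_ge0// mulr_ge0 ?le_min ?mdist_ge0 ?ltW.
have u_le z : u z <= w z.
  have := inf_conv_le id wB (ltW ei0) (ltW e0) z z.
  by rewrite mdistxx (min_l (ltW e0)) mulr0 addr0.
have phi01 z : 0 <= phi z <= 1.
  have := u0 z; have := u_le z; case/andP: (w01 z) => _.
  by rewrite /phi => h1 h2 h3; apply/andP; split; lra.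
have cphi := mdist_lip_continuous phi_lip.
have phiB z : `|phi z| <= 1 by case/andP: (phi01 z) => h0 h1; rewrite ger0_norm.
have phi_test := BL_dist_lipschitz k01 muf nuf ltr01 (ltW ei0) munu phiB phi_lip.
have mAe := measurable_enlarge A e.
have lower : fine (mu A) <= \int[mu]_z phi z.
  rewrite -(Rintegral_indic mu mA); apply: le_Rintegral => //.
  - exact: indic_integrable.
  - exact: continuous_integrable.
  - by move=> z _; have := u_le z; rewrite /phi /w; lra.
have upper : \int[nu]_z phi z <= fine (nu (enlarge A e)).
  rewrite -(Rintegral_indic nu mAe); apply: le_Rintegral => //.
  - exact: continuous_integrable.
  - exact: indic_integrable.
  move=> z _; rewrite indicE; have [zA|zA] := boolP (z \in _).
    by case/andP: (phi01 z).
  suff : 1 <= u z by rewrite /phi /=; lra.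
  apply: inf_conv_ge => x; rewrite /w indicE; have [xA|xA] := boolP (x \in A).
    have ezx : e <= mdist z x.
      rewrite leNgt; apply: contra zA => zx; rewrite inE; exists x.
        by rewrite inE in xA.
      by rewrite ballEmdist /= metric_sym.
    by rewrite min_r// mulVf ?lt0r_neq0//= subrr add0r.
  by rewrite /= subr0 lerDl mulr_ge0 ?le_min ?mdist_ge0 ?ltW.
have c_le : (3 * 1 + e^-1) * (e / (3 + e^-1)) = e.
  by rewrite mulr1 mulrCA mulfV ?mulr1// lt0r_neq0//; lra.
move: phi_test; rewrite c_le ler_norml => /andP[_]; lra.
Qed.

(** The staircase of step [t] below [x] approximates [x] to within [t].  The
    saturated case [n * t <= x] is kept apart because the induction passes
    through it. *)
Lemma indic_staircase (x t : R) n : 0 < t -> 0 <= x ->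
  let s := t * \sum_(j < n) (j.+1%:R * t <= x)%R%:R in
  (n%:R * t <= x -> s = n%:R * t) /\ (x < n%:R * t -> x - t <= s <= x).
Proof.
move=> t0 x0; elim: n => [|n [IH1 IH2]] /=.
  by rewrite big_ord0 mulr0 mul0r; split=> //; lra.
rewrite big_ord_recr /= mulrDr; set s := t * _ in IH1 IH2 *.
have nS : n.+1%:R * t = n%:R * t + t by rewrite -natr1 mulrDl mul1r.
rewrite nS; split=> [xn|xn].
  by rewrite xn mulr1 IH1//; lra.
rewrite (lt_geF xn) mulr0 addr0; have [xn'|xn'] := ltP x (n%:R * t).
  exact: IH2.
by rewrite IH1//; apply/andP; split; lra.
Qed.

Lemma prokhorov_close_mass mu nu e : 0 < e -> prokhorov_close mu nu e ->
  mass mu <= mass nu + e.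
Proof. by move=> e0 /(_ setT measurableT); rewrite enlargeT. Qed.

(** Layer-cake comparison: with step [t = N^-1], the superlevel set at height
    [(j + 2) t] enlarges by [e] into the one at height [(j + 1) t], since [h]
    varies by at most [t] over distance [e].  The lowest layer is bounded by the
    total mass instead. *)
Lemma prokhorov_close_Rintegral k mu nu N e f : 0 < k <= 1 ->
  (mu setT < +oo)%E -> (nu setT < +oo)%E ->
  (0 < N)%N -> 0 < e -> e `^ k <= N%:R^-1 ->
  prokhorov_close mu nu e -> prokhorov_close nu mu e ->
  (BL_norm k f <= 1)%E ->
  \int[mu]_z f z - \int[nu]_z f z <= N%:R^-1 * (mass mu + mass nu) + 3 * e.
Proof.
move=> k01 muf nuf N0 e0 eN munu numu /BL_norm_le1[f1 fk].
have cf : continuous f by exact: hoelder_continuous fk.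
set t := N%:R^-1 in eN *.
have t0 : 0 < t by rewrite invr_gt0 ltr0n.
(* The shift makes the function nonnegative, as the staircase requires; the price
   is the difference of the two masses, itself at most [e]. *)
pose h z := f z + 1.
have h02 z : 0 <= h z <= 2.
  by have := f1 z; rewrite ler_norml /h => /andP[f0 f2]; apply/andP; split; lra.
have ch : continuous h.
  by move=> z; apply: cvgD; [exact: cf|exact: cvg_cst].
pose A (j : nat) : set (borel Z) := [set z | j.+1%:R * t <= h z].
have mA j : measurable (A j).
  have := continuous_borel_measurable ch measurableT
    (measurable_itv `[j.+1%:R * t, +oo[).
  rewrite setTI; congr measurable; apply/seteqP.
  by split=> z /=; rewrite in_itv /= andbT.
pose s n (z : borel Z) : R := \sum_(j <- index_enum 'I_n) t * \1_(A j) z.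
have sE n z : s n z = t * \sum_(j < n) (j.+1%:R * t <= h z)%R%:R.
  rewrite /s -mulr_sumr; congr (_ * _); apply: eq_bigr => j _.
  by rewrite indicE mem_setE.
have intA (m : borel_measure Z R) : (m setT < +oo)%E -> forall j : nat,
    m.-integrable setT (EFin \o (fun z => t * \1_(A j) z)).
  move=> mf j.
  have H := integrableZl measurableT t (indic_integrable mf (mA j)).
  exact H.
have ints (m : borel_measure Z R) : (m setT < +oo)%E -> forall n,
    m.-integrable setT (EFin \o s n) /\
    \int[m]_z s n z = t * \sum_(j < n) fine (m (A j)).
  move=> mf n.
  have [h1 h2] := Rintegral_sum (index_enum 'I_n) (fun j : 'I_n => intA m mf j).
  split=> //; rewrite h2 mulr_sumr; apply: eq_bigr => j _.
  by rewrite RintegralZl// ?Rintegral_indic//; exact: indic_integrable.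
have hmu : \int[mu]_z h z <= t * mass mu + t * \sum_(j < N.*2) fine (mu (A j)).
  have [iS sI] := ints mu muf N.*2.
  rewrite -sI -(Rintegral_cst mu measurableT) -RintegralD//; last first.
    by apply: continuous_integrable => //; exact: cst_continuous.
  apply: le_Rintegral => //.
  - exact: continuous_integrable.
  - have it : mu.-integrable setT (EFin \o (cst t : borel Z -> R)).
      by apply: continuous_integrable => //; exact: cst_continuous.
    have H := integrableD measurableT it iS.
    exact H.
  move=> z _; case/andP: (h02 z) => h0 h2; rewrite sE.
  have [st1 st2] := indic_staircase N.*2 t0 h0.
  have N2t : N.*2%:R * t = 2.
    by rewrite -muln2 natrM mulrAC mulfV ?mul1r// pnatr_eq0 -lt0n.
  rewrite N2t in st1 st2; have [h2'|h2'] := leP 2 (h z).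
    by rewrite st1//; lra.
  by case/andP: (st2 h2'); lra.
have hnu : t * \sum_(j < N.*2.-1) fine (nu (A j)) <= \int[nu]_z h z.
  have [iS sI] := ints nu nuf N.*2.-1.
  rewrite -sI; apply: le_Rintegral => //.
  - exact: continuous_integrable.
  move=> z _; case/andP: (h02 z) => h0 h2; rewrite sE.
  have [st1 st2] := indic_staircase N.*2.-1 t0 h0.
  have [h2'|h2'] := leP (N.*2.-1%:R * t) (h z).
    by rewrite st1.
  by case/andP: (st2 h2').
have step j : fine (mu (A j.+1)) <= fine (nu (A j)) + e.
  apply: (le_trans (munu _ (mA j.+1))); rewrite lerD2r; apply: fine_le_measure => //.
    exact: measurable_enlarge.
  move=> z [a Aa]; rewrite ballEmdist /= => az.
  have : `|f a - f z| <= t.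
    apply: (le_trans (fk a z)); apply: le_trans eN; apply: ge0_ler_powR.
    - by case/andP: k01 => /ltW.
    - by rewrite nnegrE mdist_ge0.
    - by rewrite nnegrE ltW.
    - exact: ltW.
  rewrite ler_norml => /andP[_]; move: Aa; rewrite /A /= /h -(natr1 j.+1) mulrDl mul1r.
  lra.
have step0 : fine (mu (A 0%N)) <= mass nu + e.
  apply: (le_trans (munu _ (mA 0%N))); rewrite lerD2r; apply: fine_le_measure => //.
  exact: measurable_enlarge.
have sums : \sum_(j < N.*2) fine (mu (A j)) <=
    mass nu + \sum_(j < N.*2.-1) fine (nu (A j)) + N.*2%:R * e.
  have : (0 < N.*2)%N by rewrite double_gt0.
  case: (N.*2) => // n _; rewrite big_ord_recl /=.
  have : \sum_(i < n) fine (mu (A (bump 0 i))) <= \sum_(i < n) (fine (nu (A i)) + e).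
    by apply: ler_sum => i _; exact: step.
  rewrite big_split /= sumr_const card_ord -[e *+ n]mulr_natl -natr1 mulrDl mul1r.
  lra.
have Nt : t * (N.*2%:R * e) = 2 * e.
  by rewrite -muln2 natrM /t mulrA mulrA mulVf ?mul1r// pnatr_eq0 -lt0n.
have hsum : t * \sum_(j < N.*2) fine (mu (A j)) <=
    t * mass nu + t * \sum_(j < N.*2.-1) fine (nu (A j)) + 2 * e.
  by rewrite -Nt -!mulrDr ler_pM2l.
have intD (m : borel_measure Z R) : (m setT < +oo)%E ->
    \int[m]_z h z = \int[m]_z f z + mass m.
  move=> mf; rewrite -[mass m]mul1r -(Rintegral_cst m measurableT) -RintegralD//.
    exact: continuous_integrable.
  by apply: continuous_integrable => //; exact: cst_continuous.
have := prokhorov_close_mass e0 numu.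
move: hmu hnu; rewrite !intD// mulrDr; lra.
Qed.

Lemma BL_dist_le_prokhorov k mu nu N e : 0 < k <= 1 ->
  (mu setT < +oo)%E -> (nu setT < +oo)%E ->
  (0 < N)%N -> 0 < e -> e `^ k <= N%:R^-1 ->
  (prokhorov_dist mu nu < e%:E)%E ->
  (BL_dist k mu nu <= (N%:R^-1 * (2 * mass mu + e) + 3 * e)%:E)%E.
Proof.
move=> k01 muf nuf N0 e0 eN /(prokhorov_dist_lt muf nuf) [d /andP[d0 de] [munu numu]].
have dN : d `^ k <= N%:R^-1.
  apply: le_trans eN; apply: ge0_ler_powR; rewrite ?nnegrE ?ltW//.
  by case/andP: k01.
have N0' : 0 < N%:R^-1 :> R by rewrite invr_gt0 ltr0n.
have mass_nu := prokhorov_close_mass d0 numu.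
have bound : N%:R^-1 * (mass mu + mass nu) + 3 * d <= N%:R^-1 * (2 * mass mu + e) + 3 * e.
  by rewrite lerD//; [rewrite ler_pM2l//; lra|lra].
apply: ge_ereal_sup => _ [f /= fk <-]; rewrite lee_fin ler_norml.
have h1 := prokhorov_close_Rintegral k01 muf nuf N0 d0 dN munu numu fk.
have h2 := prokhorov_close_Rintegral k01 nuf muf N0 d0 dN numu munu fk.
rewrite [mass nu + _]addrC in h2.
by apply/andP; split; lra.
Qed.

End prokhorov.

(** * Weak convergence implies convergence in the bounded Hoelder distance *)

Section weak_convergence.
Context (R : realType) (Z : compactMetricType R).
Implicit Types (mu nu : borel_measure Z R) (f : Z -> R).

Lemma finite_net (d : R) : 0 < d ->
  exists s : seq Z, forall z, exists2 c, c \in s & mdist c z < d.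
Proof.
move=> d0; have := @compactT _ Z; rewrite compact_cover.
move=> /(_ Z setT (fun c => (ball c d)^°)).
case=> [c _|z _|D _ DP]; first exact: open_interior.
  by exists z => //; exact: nbhsx_ballx.
exists (enum_fset D) => z; have [c cD /interior_subset] := DP z I.
by rewrite ballEmdist; exists c.
Qed.

Lemma continuous_sum (I : Type) (s : seq I) (f : I -> Z -> R) :
  (forall i, continuous (f i)) -> continuous (fun z => \sum_(i <- s) f i z).
Proof.
move=> cf; elim: s => [|i s IH].
  by under eq_fun do rewrite big_nil; exact: cst_continuous.
under eq_fun do rewrite big_cons.
by move=> z; apply: cvgD; [exact: cf|exact: IH].
Qed.

(** Normalized tents of radius [d] over a finite [d]-net. *)
Lemma partition_of_unity (d : R) : 0 < d ->
  exists (s : seq Z) (phi : Z -> Z -> R),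
  [/\ forall c, continuous (phi c), forall c z, 0 <= phi c z,
      forall z, \sum_(c <- s) phi c z = 1 &
      forall c z, d <= mdist c z -> phi c z = 0].
Proof.
move=> d0; have [s sP] := finite_net d0.
pose psi (c z : Z) : R := Num.max 0 (d - mdist c z).
pose S z := \sum_(c <- s) psi c z.
have psi0 c z : 0 <= psi c z by rewrite le_max lexx.
have cpsi c : continuous (psi c).
  apply: (@mdist_lip_continuous _ _ _ 1) => x y; rewrite mul1r /psi.
  have := metric_triangle c x y; have := metric_triangle c y x.
  rewrite (metric_sym y x) => h1 h2.
  rewrite ler_norml; apply/andP.
  by case: (leP 0 (d - mdist c x)) => ?; case: (leP 0 (d - mdist c y)) => ?;
    split; have := mdist_ge0 x y; lra.
have cS : continuous S by exact: continuous_sum.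
have S0 z : 0 < S z.
  have [c cs cz] := sP z; rewrite /S (big_rem c)//=.
  rewrite ltr_pwDl ?sumr_ge0// /psi lt_max subr_gt0 cz orbT//.
exists s, (fun c z => psi c z / S z); split.
- move=> c z; apply: cvgM; first exact: cpsi.
  apply: cvgV; first by rewrite gt_eqF.
  exact: cS z.
- by move=> c z; exact: divr_ge0 (psi0 c z) (ltW (S0 z)).
- by move=> z; rewrite -mulr_suml -/(S z) mulfV ?gt_eqF.
- by move=> c z dcz; rewrite /psi max_l ?mul0r// subr_le0.
Qed.

Lemma weak_cvg_mass (mu_ : nat -> borel_measure Z R) mu :
  weak_cvg mu_ mu -> mass (mu_ n) @[n --> \oo] --> mass mu.
Proof.
have E (m : borel_measure Z R) : \int[m]_z (cst 1 : Z -> R) z = mass m.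
  by rewrite Rintegral_cst// mul1r.
move=> /(_ (cst 1) (@cst_continuous _ _ _) (bounded_cst _ _)).
by rewrite E; under eq_fun do rewrite E.
Qed.

(** Replacing [f] by the combination of the partition of unity with
    coefficients [f c] costs at most [d `^ k] uniformly in [f], after which only
    finitely many integrals, common to all [f], have to converge. *)
Lemma weak_cvg_BL_dist k (mu_ : nat -> borel_measure Z R) mu : 0 < k <= 1 ->
  (forall n, (mu_ n setT < +oo)%E) -> (mu setT < +oo)%E -> weak_cvg mu_ mu ->
  forall e, 0 < e -> \forall n \near \oo, (BL_dist k (mu_ n) mu <= e%:E)%E.
Proof.
move=> k01 mu_f muf mu_cvg e e0; have k0 : 0 < k by case/andP: k01.
have m0 := mass_ge0 mu.
(* The radius [d] below satisfies [d `^ k = e / D], so that the uniform error,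
   integrated against both measures, is at most [e / 2] once the mass of
   [mu_ n] is below [mass mu + 1]. *)
pose D : R := 2 * (2 * mass mu + 1).
have D0 : 0 < D by rewrite /D; lra.
have eD0 : 0 < e / D by rewrite divr_gt0.
pose d := (e / D) `^ k^-1.
have d0 : 0 < d by exact: powR_gt0.
have dk : d `^ k = e / D.
  by rewrite /d -powRrM mulVf ?lt0r_neq0// powRr1// ltW.
have [s [phi [cphi phi0 phi1 phid]]] := partition_of_unity d0.
pose err n := \sum_(c <- s) `|\int[mu_ n]_z phi c z - \int[mu]_z phi c z|.
have err_cvg : err n @[n --> \oo] --> 0.
  rewrite /err; elim: s {phi1 err} => [|c s IH].
    under eq_fun do rewrite big_nil; exact: cvg_cst.
  under eq_fun do rewrite big_cons.
  have phi_cvg := mu_cvg _ (cphi c) (continuous_bounded_fun (cphi c)).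
  have h : `|\int[mu_ n]_z phi c z - \int[mu]_z phi c z| @[n --> \oo] --> (0 : R).
    rewrite -(normr0 R); apply: cvg_norm; rewrite -(subrr (\int[mu]_z phi c z)).
    by apply: cvgB => //; exact: cvg_cst.
  by have := cvgD h IH; rewrite addr0; apply.
have e20 : 0 < e / 2 by lra.
near=> n.
have err_n : err n < e / 2.
  by near: n; apply: cvgr_lt err_cvg _ _.
have mass_n : mass (mu_ n) < mass mu + 1.
  by near: n; apply: cvgr_lt (weak_cvg_mass mu_cvg) _ _; rewrite ltrDl.
apply: ge_ereal_sup => _ [f /= /(BL_norm_le1)[f1 fk] <-]; rewrite lee_fin.
have cf := hoelder_continuous k01 fk.
pose F z := \sum_(c <- s) f c * phi c z.
have ctF c : continuous (fun z => f c * phi c z).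
  by move=> z; apply: cvgM; [exact: cvg_cst|exact: cphi].
have cF : continuous F by exact: continuous_sum.
have fF z : `|f z - F z| <= d `^ k.
  rewrite -[f z]mulr1 -(phi1 z) mulr_sumr -sumrB.
  apply: (le_trans (ler_norm_sum _ _ _)).
  rewrite -[leRHS]mulr1 -(phi1 z) mulr_sumr; apply: ler_sum => c _.
  rewrite -mulrBl normrM (ger0_norm (phi0 c z)).
  have [dcz|dcz] := leP d (mdist c z); first by rewrite phid// !mulr0.
  apply: ler_wpM2r => //; apply: (le_trans (fk z c)); rewrite metric_sym.
  apply: ge0_ler_powR; rewrite ?nnegrE ?mdist_ge0//; exact: ltW.
have intF (m : borel_measure Z R) : (m setT < +oo)%E ->
    \int[m]_z F z = \sum_(c <- s) f c * \int[m]_z phi c z.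
  move=> mf; have [|_ ->] := @Rintegral_sum _ _ m _ s (fun c z => f c * phi c z).
    by move=> c; exact: continuous_integrable.
  by apply: eq_bigr => c _; rewrite RintegralZl//; exact: continuous_integrable.
have FF : `|\int[mu_ n]_z F z - \int[mu]_z F z| <= err n.
  rewrite !intF// -sumrB; apply: (le_trans (ler_norm_sum _ _ _)).
  by apply: ler_sum => c _; rewrite -mulrBr normrM ler_piMl.
have h1 := Rintegral_dist (mu_f n) cf cF fF.
have h2 := Rintegral_dist muf cf cF fF.
have hD : d `^ k * (mass (mu_ n) + mass mu) <= e / 2.
  rewrite dk; apply: (@le_trans _ _ (e / D * (2 * mass mu + 1))).
    by rewrite ler_pM2l//; lra.
  have -> : 2 * mass mu + 1 = D / 2 by rewrite /D; field.
  by rewrite mulrA mulfVK ?lt0r_neq0.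
have := ler_distD (\int[mu_ n]_z F z) (\int[mu_ n]_z f z) (\int[mu]_z f z).
have := ler_distD (\int[mu]_z F z) (\int[mu_ n]_z F z) (\int[mu]_z f z).
rewrite distrC in h2.
rewrite mulrDr in hD; lra.
Unshelve. all: by end_near. Qed.

End weak_convergence.

(** * Gluing a sequence of compact spaces along a common hub *)

(** For each [A], either [A] or its complement has its preimage in [F], and the
    complement cannot be in a proper filter that contains [A]. *)
Lemma fmap_ultra T U (f : T -> U) (F : set_system T) :
  UltraFilter F -> UltraFilter (f @ F).
Proof.
move=> UF; constructor; first exact: fmap_proper_filter.
move=> H PH FH; apply/seteqP; split=> [A HA|//].
have [//|FnA] := in_ultra_setVsetC (f @^-1` A) UF.
have HnA : H (~` A) by exact: FH.
by have := @filter_not_empty _ H PH; rewrite -(setICr A) => /(_ (filterI HA HnA)).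
Qed.

Section gluing.
Variable R : realType.

(** [c p x] plays the distance from a point [p] of [X] to a point [x] of [Y]:
    the conditions say that it extends the two metrics to one on the disjoint
    union, in which each space lies within [s] of the other.  The positive lower
    bound keeps the two spaces disjoint. *)
Record link (X Y : compactMetricType R) (c : X -> Y -> R) (s : R) : Prop :=
  Link {
    link_gt0 : exists2 e, 0 < e & forall p x, e <= c p x ;
    link_triangleL : forall p q x, c p x <= mdist p q + c q x ;
    link_detourL : forall p q x, mdist p q <= c p x + c q x ;
    link_triangleR : forall p x y, c p x <= c p y + mdist x y ;
    link_detourR : forall p x y, mdist x y <= c p x + c p y ;
    link_nearR : forall p, exists x, c p x <= s ;
    link_nearL : forall x, exists p, c p x <= s
  }.

Record gluing := Gluing {
  hub : compactMetricType R ;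
  branch : nat -> compactMetricType R ;
  bridge : forall n, branch n -> hub -> R ;
  slack : nat -> R ;
  bridgeP : forall n, link (@bridge n) (slack n) ;
  slack_cvg : slack n @[n --> \oo] --> 0
}.

Definition piece G (i : option nat) : compactMetricType R :=
  if i is Some n then branch G n else hub G.

(** The hub is itself treated as a piece, linked to the hub by its own metric,
    so that the triangle inequality needs no separate cases for it. *)
Definition rho G (i : option nat) : piece G i -> hub G -> R :=
  if i is Some n then @bridge G n else fun x y => mdist x y.

Lemma rho_pieceL G i (p q : piece G i) x : rho p x <= mdist p q + rho q x.
Proof.
case: i p q => [n|] p q; first exact: link_triangleL (bridgeP G n) _ _ _.
exact: metric_triangle.
Qed.

Lemma rho_pieceR G i (p q : piece G i) x : mdist p q <= rho p x + rho q x.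
Proof.
case: i p q => [n|] p q; first exact: link_detourL (bridgeP G n) _ _ _.
by rewrite /= [mdist q x]metric_sym metric_triangle.
Qed.

Lemma rho_hubL G i (p : piece G i) x y : rho p x <= rho p y + mdist x y.
Proof.
case: i p => [n|] p; first exact: link_triangleR (bridgeP G n) _ _ _.
by rewrite /= [mdist x y]metric_sym metric_triangle.
Qed.

Lemma rho_hubR G i (p : piece G i) x y : mdist x y <= rho p x + rho p y.
Proof.
case: i p => [n|] p; first exact: link_detourR (bridgeP G n) _ _ _.
by rewrite /= [mdist p x]metric_sym metric_triangle.
Qed.

Definition glued (G : gluing) : Type := {i & piece G i}.

HB.instance Definition _ G := gen_eqMixin (glued G).
HB.instance Definition _ G := gen_choiceMixin (glued G).
HB.instance Definition _ G :=
  isPointed.Build (glued G) (existT (piece G) None (point : hub G)).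

Variable G : gluing.
Implicit Types (p q r : glued G) (x y : hub G).

Definition hop p q x := rho (tagged p) x + rho (tagged q) x.

(** Two points in the same piece keep their distance; otherwise the shortest
    detour through a point of the hub is taken. *)
Definition glued_dist p q : R :=
  if tag p == tag q then mdist (tagged p) (tagged_as p q)
  else inf (range (hop p q)).

Lemma rho_ge0 i (p : piece G i) x : 0 <= rho p x.
Proof.
by have := rho_pieceR p p x; have := mdist_ge0 p p; lra.
Qed.

Lemma glued_dist_piece i (p q : piece G i) :
  glued_dist (existT _ i p) (existT _ i q) = mdist p q.
Proof. by rewrite /glued_dist eqxx tagged_asE. Qed.

Lemma has_inf_hop p q : has_inf (range (hop p q)).
Proof.
split; first by exists (hop p q point), point.
by exists 0 => _ [x _ <-]; rewrite addr_ge0// rho_ge0.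
Qed.

Lemma glued_dist_le_hop p q x : glued_dist p q <= hop p q x.
Proof.
rewrite /glued_dist; case: eqVneq => [|_].
  case: p q => [i p] [j q] /= ij; case: j / ij q => q.
  by rewrite tagged_asE; exact: rho_pieceR.
by apply: ge_inf; [case: (has_inf_hop p q)|exists x].
Qed.

Lemma glued_dist_hop p q : tag p != tag q ->
  forall e, 0 < e -> exists x, hop p q x < glued_dist p q + e.
Proof.
move=> pq e e0; rewrite /glued_dist (negbTE pq).
by have [_ [x _ <-] xe] := inf_adherent e0 (has_inf_hop p q); exists x.
Qed.

Lemma glued_distC p q : glued_dist p q = glued_dist q p.
Proof.
rewrite /glued_dist [tag q == _]eq_sym; case: eqVneq => [|_].
  case: p q => [i p] [j q] /= ij; case: j / ij q => q.
  by rewrite !tagged_asE metric_sym.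
by rewrite (_ : hop p q = hop q p)//; apply/funext => x; rewrite /hop addrC.
Qed.

(** The triangle inequality when one of the points is in the hub, from which
    the general case follows: at least one of two hops changes piece, unless all
    three points lie in the same one. *)
Lemma rho_le_glued_dist p q x :
  rho (tagged p) x <= glued_dist p q + rho (tagged q) x.
Proof.
have [|pq] := eqVneq (tag p) (tag q).
  case: p q => [i p] [j q] /= ij; case: j / ij q => q.
  by rewrite glued_dist_piece; exact: rho_pieceL.
apply/ler_addgt0Pl => e e0; have [y] := glued_dist_hop pq e0; rewrite /hop.
have := rho_hubL (tagged p) x y; have := rho_hubR (tagged q) x y; lra.
Qed.

Lemma glued_dist_triangle q p r :
  glued_dist p r <= glued_dist p q + glued_dist q r.
Proof.
have [pq|pq] := eqVneq (tag p) (tag q); last first.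
  apply/ler_addgt0Pl => e e0; have [x] := glued_dist_hop pq e0.
  have := glued_dist_le_hop p r x; have := rho_le_glued_dist r q x.
  rewrite /hop (glued_distC r); lra.
have [qr|qr] := eqVneq (tag q) (tag r); last first.
  apply/ler_addgt0Pl => e e0; have [x] := glued_dist_hop qr e0.
  have := glued_dist_le_hop p r x; have := rho_le_glued_dist p q x.
  rewrite /hop; lra.
case: p q r pq qr => [i p] [j q] [k r] /= ij jk.
case: j / ij q jk => q jk; case: k / jk r => r.
by rewrite !glued_dist_piece metric_triangle.
Qed.

Lemma hop_gt0 p q : tag p != tag q ->
  exists2 e, 0 < e & forall x, e <= hop p q x.
Proof.
case: p q => [[n|] p] [[m|] q] //= pq.
- have [e e0 eP] := link_gt0 (bridgeP G n); exists e => // x.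
  by rewrite /hop (le_trans (eP p x))// lerDl rho_ge0.
- have [e e0 eP] := link_gt0 (bridgeP G n); exists e => // x.
  by rewrite /hop (le_trans (eP p x))// lerDl rho_ge0.
- have [e e0 eP] := link_gt0 (bridgeP G m); exists e => // x.
  by rewrite /hop (le_trans (eP q x))// lerDr rho_ge0.
Qed.

Lemma glued_dist_eq0 p q : glued_dist p q = 0 -> p = q.
Proof.
have [|pq] := eqVneq (tag p) (tag q).
  case: p q => [i p] [j q] /= ij; case: j / ij q => q.
  by rewrite glued_dist_piece => /mdist_positivity ->.
have [e e0 eP] := hop_gt0 pq => d0.
have [x] := glued_dist_hop pq e0.
by rewrite d0 add0r ltNge eP.
Qed.

Lemma glued_distxx p : glued_dist p p = 0.
Proof. by case: p => i p; rewrite glued_dist_piece mdistxx. Qed.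

HB.instance Definition _ := @isMetric.Build R (glued G) glued_dist
  glued_distxx glued_dist_eq0 glued_distC glued_dist_triangle.

Definition in_piece i (p : piece G i) : glued G := existT _ i p.

Lemma in_piece_isometric i (p q : piece G i) :
  mdist (in_piece p) (in_piece q) = mdist p q.
Proof. exact: glued_dist_piece. Qed.

Lemma compact_piece i : compact [set p : glued G | tag p = i].
Proof.
rewrite (_ : [set _ | _] = range (@in_piece i)); last first.
  apply/seteqP; split=> [[j p] /= ji|_ [p _ <-]//].
  by case: i / ji; exists p.
apply: continuous_compact; last exact: compactT.
apply: continuous_subspaceT => p.
apply/(@metricType_numDomainType.cvgrPdist_lt _ (glued G)) => e e0.
have /= := @metricType_numDomainType.cvgr_dist_lt _ (piece G i) _ (nbhs p)
  (nbhs_filter p) id p (@cvg_id _ (nbhs p)) e e0.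
by apply: filterS => q; rewrite in_piece_isometric.
Qed.

Lemma mdist_hub p x : mdist p (@in_piece None x) <= rho (tagged p) x.
Proof.
by rewrite (le_trans (glued_dist_le_hop _ _ x))// /hop/= mdistxx addr0.
Qed.

(** An ultrafilter either contains a piece, which is compact, or avoids each of
    them.  In the latter case it lives where the slack is arbitrarily small, so
    its image under a nearest-hub-point map converges in the hub, and it has the
    same limit. *)
Lemma glued_compact : compact [set: glued G].
Proof.
rewrite compact_ultra => F UF _.
have [[i Fi]|nF] := pselect (exists i, F [set p : glued G | tag p = i]).
  have := @compact_piece i; rewrite compact_ultra => /(_ _ UF Fi); case=> p [_ Fp].
  by exists p.
have near_hub p : exists x,
    rho (tagged p) x <= if tag p is Some n then slack G n else 0.
  case: p => [[n|] p] /=; first exact: link_nearR (bridgeP G n) p.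
  by exists p; rewrite mdistxx.
have [r rP] := choice near_hub.
have Ftag N : F [set p | forall n, (n < N)%N -> tag p <> Some n].
  elim: N => [|N IH]; first by apply: filterS filterT.
  have [FN|FN] := in_ultra_setVsetC [set p | tag p = Some N] UF.
    by case: nF; exists (Some N).
  apply: filterS2 IH FN => p pN pNN n.
  by rewrite ltnS leq_eqVlt => /predU1P[->//|]; exact: pN.
have := @compactT _ (hub G); rewrite compact_ultra.
move=> /(_ (r @ F) (fmap_ultra r UF) filterT) [x [_ rx]].
exists (@in_piece None x); split=> //.
apply/(@metricType_numDomainType.fcvgrPdist_lt _ (glued G) F _) => e e0.
have e20 : 0 < e / 2 by lra.
have /cvgrPdist_lt/(_ _ e20) [N _ NP] := @slack_cvg G.
have rFx : F [set p | mdist x (r p) < e / 2].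
  have := rx _ (nbhsx_ballx x _ e20).
  by apply: (@filterS _ F) => p; rewrite /= ballEmdist.
suff : F [set p | mdist (@in_piece None x) p < e] by [].
apply: filterS2 (Ftag N) rFx => p pN rpx.
rewrite /= metric_sym (le_lt_trans (mdist_hub p x))//.
rewrite (le_lt_trans (rho_hubL (tagged p) x (r p)))//.
suff : rho (tagged p) (r p) < e / 2 by move: rpx => /=; lra.
apply: (le_lt_trans (rP p)); move: pN => /=; case: (tag p) => [n pN|//].
have Nn : (N <= n)%N by rewrite leqNgt; apply/negP => /pN/(_ erefl).
have := NP n Nn; rewrite /= sub0r normrN; exact: le_lt_trans (ler_norm _).
Qed.

HB.instance Definition _ := isCompactSpace.Build (glued G) glued_compact.

End gluing.

(** * Hausdorff distance, common embeddings and transport of integrals *)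

Section hausdorff.
Context (R : realType) (Z : compactMetricType R).
Implicit Types (A B : set Z) (e : R).

Lemma hausdorff_dist_ge0 A B : (0 <= hausdorff_dist A B)%E.
Proof.
by apply/ereal_infP => _ [e [e0 _ _] <-]; rewrite lee_fin ltW.
Qed.

Lemma hausdorff_dist_lt A B e : (hausdorff_dist A B < e%:E)%E ->
  (forall a, A a -> exists2 b, B b & mdist a b < e) /\
  (forall b, B b -> exists2 a, A a & mdist a b < e).
Proof.
move=> /ereal_inf_lt [_ [d [d0 AB BA] <-]]; rewrite lte_fin => de.
split=> [a /AB [b Bb]|b /BA [a Aa]]; rewrite ballEmdist /= => ab.
  by exists b => //; rewrite metric_sym (lt_trans ab).
by exists a => //; rewrite (lt_trans ab).
Qed.

Lemma hausdorff_dist_le A B e : 0 < e ->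
  (forall a, A a -> exists2 b, B b & mdist a b < e) ->
  (forall b, B b -> exists2 a, A a & mdist a b < e) ->
  (hausdorff_dist A B <= e%:E)%E.
Proof.
move=> e0 AB BA; apply: ereal_inf_lbound; exists e => //; split=> //.
  by move=> a /AB [b Bb ab]; exists b => //; rewrite ballEmdist /= metric_sym.
by move=> b /BA [a Aa ab]; exists a => //; rewrite ballEmdist.
Qed.

End hausdorff.

Section embedding_dist.
Context (R : realType).
Variable delta : forall Z : compactMetricType R,
  borel_measure Z R -> borel_measure Z R -> \bar R.
Arguments delta : clear implicits.

Lemma embedding_dist_ge0 (X Y : mcms R) : (0 <= embedding_dist delta X Y)%E.
Proof.
apply/ereal_infP => _ [Z [f [g ->]]].
by rewrite le_max hausdorff_dist_ge0.
Qed.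

Lemma embedding_dist_lt (X Y : mcms R) (e : R) :
  (embedding_dist delta X Y < e%:E)%E ->
  exists (Z : compactMetricType R) (f : isometric_embedding X Z)
    (g : isometric_embedding Y Z),
    (hausdorff_dist (range f) (range g) < e%:E)%E /\
    (delta Z (image_measure (mcms_measure X) f)
             (image_measure (mcms_measure Y) g) < e%:E)%E.
Proof.
move=> /ereal_inf_lt [_ [Z [f [g ->]]]]; rewrite gt_max => /andP[h1 h2].
by exists Z, f, g.
Qed.

Lemma embedding_dist_le (X Y : mcms R) (e : \bar R) (Z : compactMetricType R)
    (f : isometric_embedding X Z) (g : isometric_embedding Y Z) :
  (hausdorff_dist (range f) (range g) <= e)%E ->
  (delta Z (image_measure (mcms_measure X) f)
           (image_measure (mcms_measure Y) g) <= e)%E ->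
  (embedding_dist delta X Y <= e)%E.
Proof.
move=> h1 h2; apply: ge_ereal_inf; eexists; first by exists Z, f, g.
by rewrite ge_max h1.
Qed.

End embedding_dist.

(** Convergence of extended reals to 0 by real thresholds; finiteness is only
    obtained eventually. *)
Lemma cvge0P (R : realType) (u : nat -> \bar R) : (forall n, 0 <= u n)%E ->
  u n @[n --> \oo] --> 0%E <->
  forall e : R, 0 < e -> \forall n \near \oo, (u n < e%:E)%E.
Proof.
move=> u0; split=> [ucvg e e0|H].
  have := ucvg [set x | (x < e%:E)%E]; apply.
  apply: (@open_nbhs_nbhs _ 0%E); split; first exact: open_ereal_lt_ereal.
  by rewrite /= lte_fin.
have fin : \forall n \near \oo, u n \is a fin_num.
  by apply: filterS (H 1 ltr01) => n un; rewrite ge0_fin_numE// (lt_trans un)// ltry.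
apply/fine_cvgP; split=> //; apply/cvgrPdist_lt => e e0.
apply: filterS2 fin (H e e0) => n ufin un.
by rewrite sub0r normrN ger0_norm ?fine_ge0// -lte_fin fineK.
Qed.

Section links.
Context (R : realType).

(** Two compact spaces can always be linked, at a constant distance at least
    both diameters; this serves for the finitely many indices at which no good
    common embedding is available. *)
Lemma constant_link (X Y : compactMetricType R) :
  exists C : R, link (fun (_ : X) (_ : Y) => C) C.
Proof.
have bnd (Z : compactMetricType R) : exists2 C, 0 < C & forall x y : Z, mdist x y <= C.
  have [|B B0 BP] := @compact_space_bounded _ Z (mdist point).
    apply: (@mdist_lip_continuous _ _ _ 1) => x y; rewrite mul1r.
    have := metric_triangle point x y; have := metric_triangle point y x.
    rewrite (metric_sym y x) ler_norml => h1 h2.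
    by apply/andP; split; lra.
  exists (B + B); first by lra.
  move=> x y; apply: (le_trans (metric_triangle x point y)).
  by rewrite (metric_sym x) lerD// (le_trans (ler_norm _)).
have [C C0 CP] := bnd X; have [D D0 DP] := bnd Y.
exists (C + D); split.
- by exists (C + D) => [|_ _]; lra.
- by move=> p q _; have := mdist_ge0 p q; lra.
- by move=> p q _; have := CP p q; lra.
- by move=> _ x y; have := mdist_ge0 x y; lra.
- by move=> _ x y; have := DP x y; lra.
- by move=> _; exists point.
- by move=> _; exists point.
Qed.

(** Adding [s] to the distances of a common embedding separates the two images,
    which may intersect. *)
Lemma embedding_link (X Y Z : compactMetricType R)
    (f : isometric_embedding X Z) (g : isometric_embedding Y Z) (s : R) :
  0 < s -> (hausdorff_dist (range f) (range g) < s%:E)%E ->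
  link (fun p x => mdist (f p) (g x) + s) (s + s).
Proof.
move=> s0 /hausdorff_dist_lt [fg gf]; split.
- by exists s => // p x; rewrite lerDr mdist_ge0.
- by move=> p q x; rewrite -(emb_isometric f) addrA lerD2r metric_triangle.
- move=> p q x; rewrite -(emb_isometric f).
  have := metric_triangle (f p) (g x) (f q); rewrite (metric_sym (g x)); lra.
- move=> p x y; rewrite -(emb_isometric g).
  have := metric_triangle (f p) (g y) (g x); rewrite (metric_sym (g y)); lra.
- move=> p x y; rewrite -(emb_isometric g).
  have := metric_triangle (g x) (f p) (g y); rewrite (metric_sym (g x) (f p)); lra.
- move=> p; have [|_ [x _ <-] px] := fg (f p); first by exists p.
  by exists x; rewrite lerD2r ltW.
- move=> x; have [|_ [p _ <-] px] := gf (g x); first by exists x.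
  by exists p; rewrite lerD2r ltW.
Qed.

End links.

Section transfer.
Context (R : realType) (k : R) (M Z : compactMetricType R) (X Y : mcms R).
Variables (i : isometric_embedding X M) (j : isometric_embedding Y M).
Variables (f : isometric_embedding X Z) (g : isometric_embedding Y Z).

Let mu := mcms_measure X.
Let nu := mcms_measure Y.

(** Compares two integrals of [h] over [M] with the help of a common embedding
    in another space [Z].  The inf-convolution with cones of slope
    [L = 2 * B / d] over the values of [h] on [Y] does it: a cone whose apex is
    farther than [d] is at least [- B + 2 * B], above all values of [h], so only
    apexes within [d] matter, and there [h] oscillates by less than [eta].  The
    constants do not involve [Z]. *)
Lemma BL_dist_transfer (h : M -> R) (B eta d r : R) :
  0 < k <= 1 -> continuous h -> 0 < B -> (forall z, `|h z| <= B) ->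
  0 < d -> (forall x y, mdist x y < d + d -> `|h x - h y| < eta) ->
  0 < r < d ->
  (forall p, exists2 x, mdist (f p) (g x) < r & mdist (i p) (j x) < d + d) ->
  (BL_dist k (image_measure mu f) (image_measure nu g) <= r%:E)%E ->
  forall L, L = 2 * B / d ->
  `|\int[image_measure mu i]_z h z - \int[image_measure nu j]_z h z| <=
  (2 * eta + L * r) * mass mu + (9 * B + L) * r + (eta + L * r) * mass nu.
Proof.
move=> k01 ch B0 hB d0 hd /andP[r0 rd] fg munu L LE.
have L0 : 0 <= L by rewrite LE divr_ge0//; lra.
have Ld : L * d = 2 * B by rewrite LE mulfVK// gt_eqF.
have eta0 : 0 < eta.
  by have := hd (j point) (j point); rewrite mdistxx subrr normr0; apply; lra.
pose w (x : Y) := h (j x).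
have wB x : `|w x| <= B by exact: hB.
pose u := inf_conv g w L d.
have u_lip := inf_conv_lipschitz g wB L0 (ltW d0).
have u_bd z : `|u z| <= 3 * B.
  by apply: (le_trans (inf_conv_bounded g wB L0 (ltW d0) z)); lra.
have cu : continuous u := mdist_lip_continuous u_lip.
have u_near z x : mdist z (g x) < r -> `|u z - h (j x)| <= eta + L * r.
  move=> zx.
  have upper : u z <= h (j x) + L * r.
    apply: (le_trans (inf_conv_le g wB L0 (ltW d0) z x)).
    by rewrite lerD2l ler_wpM2l// ge_min ltW.
  have lower : h (j x) - eta <= u z.
    apply: inf_conv_ge => y; have [zy|zy] := leP d (mdist z (g y)).
      have := hB (j y); have := hB (j x); rewrite !ler_norml /w Ld.
      move=> /andP[h1 h2] /andP[h3 h4].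
      lra.
    have : 0 <= L * mdist z (g y) by rewrite mulr_ge0 ?mdist_ge0.
    have : `|h (j x) - h (j y)| < eta.
      apply: hd; rewrite emb_isometric -(emb_isometric g).
      have := metric_triangle (g x) z (g y); rewrite (metric_sym (g x) z); lra.
    by rewrite ltr_norml /w => /andP[_ h1] h2; lra.
  have : 0 <= L * r by apply: mulr_ge0 => //; exact: ltW.
  by move=> Lr; rewrite ler_norml; apply/andP; split; lra.
have muf := mcms_finite X; have nuf := mcms_finite Y.
rewrite !Rintegral_image//.
have B3 : 0 < 3 * B by lra.
have imuf : (image_measure mu f setT < +oo)%E by rewrite image_measure_setT.
have inuf : (image_measure nu g setT < +oo)%E by rewrite image_measure_setT.
have test := BL_dist_lipschitz k01 imuf inuf B3 L0 munu u_bd u_lip.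
rewrite -/u !Rintegral_image// in test.
have near_mu p : `|h (i p) - u (f p)| <= 2 * eta + L * r.
  have [x fpx ipx] := fg p.
  have := hd _ _ ipx; have := u_near _ _ fpx.
  have := ler_distD (h (j x)) (h (i p)) (u (f p)).
  by rewrite [X in _ <= _ + X]distrC; lra.
have near_nu x : `|h (j x) - u (g x)| <= eta + L * r.
  by rewrite distrC; apply: u_near; rewrite mdistxx.
have h1 := Rintegral_dist muf (continuous_comp_emb ch) (continuous_comp_emb cu) near_mu.
have h2 := Rintegral_dist nuf (continuous_comp_emb ch) (continuous_comp_emb cu) near_nu.
have h3 := ler_distD (\int[mu]_x u (f x)) (\int[mu]_x h (i x)) (\int[nu]_x h (j x)).
have h4 := ler_distD (\int[nu]_x u (g x)) (\int[mu]_x u (f x)) (\int[nu]_x h (j x)).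
rewrite distrC in h2.
have h5 : 3 * (3 * B) = 9 * B by ring.
rewrite h5 in test; move: h1 h2 h3 h4 test; rewrite -/mu -/nu /=; lra.
Qed.

End transfer.

(** * The equivalence and the equality of topologies *)

Section embedded_convergence.
Context (R : realType) (k : R).
Hypothesis k01 : 0 < k <= 1.

Lemma image_measure_finite (X : mcms R) (Z : compactMetricType R)
    (f : isometric_embedding X Z) :
  (image_measure (mcms_measure X) f setT < +oo)%E.
Proof. by rewrite image_measure_setT; exact: mcms_finite. Qed.

Lemma embedded_cvg_dist_BL (X_ : nat -> mcms R) (X : mcms R) :
  embedded_cvg X_ X -> dist_BL k (X_ n) X @[n --> \oo] --> 0%E.
Proof.
move=> [M [f_ [f [H W]]]].
apply/cvge0P => [n|e e0]; first exact: embedding_dist_ge0.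
have e20 : 0 < e / 2 by lra.
have BL_near := weak_cvg_BL_dist k01
  (fun n => image_measure_finite (f_ n)) (image_measure_finite f) W e20.
have H_near := (cvge0P (fun n => hausdorff_dist_ge0 _ _)).1 H _ e20.
apply: filterS2 H_near BL_near => n Hn BLn.
apply: (@le_lt_trans _ _ (e / 2)%:E); last by rewrite lte_fin; lra.
by apply: embedding_dist_le BLn; exact: ltW.
Qed.

(** The link [c] comes from a common embedding that is good to within [s] for
    both the spaces and the measures. *)
Definition realized (X Y : mcms R) (c : X -> Y -> R) (s : R) : Prop :=
  exists (Z : compactMetricType R) (f : isometric_embedding X Z)
    (g : isometric_embedding Y Z),
  [/\ c = (fun p x => mdist (f p) (g x) + s),
    (hausdorff_dist (range f) (range g) < s%:E)%E &
    (BL_dist k (image_measure (mcms_measure X) f)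
               (image_measure (mcms_measure Y) g) < s%:E)%E].

(** The infimum in [dist_BL] need not be attained, whence the margin [r]. *)
Lemma link_exists (X Y : mcms R) (r : R) : 0 < r ->
  exists cs : (X -> Y -> R) * R, link cs.1 cs.2 /\
    ((dist_BL k X Y < +oo)%E -> exists2 s, 0 < s <= fine (dist_BL k X Y) + r &
       cs.2 = s + s /\ realized cs.1 s).
Proof.
move=> r0; (* When the distance is infinite the constant link will do. *)
have [Dfin|Dinf] := boolP (dist_BL k X Y < +oo)%E; last first.
  by have [C CP] := constant_link X Y; exists (fun _ _ => C, C).
have D0 : (0 <= dist_BL k X Y)%E by exact: embedding_dist_ge0.
set s := fine (dist_BL k X Y) + r.
have s0 : 0 < s by rewrite ltr_wpDl// fine_ge0.
have : (dist_BL k X Y < s%:E)%E.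
  by rewrite /s EFinD fineK ?ge0_fin_numE// lteDl// ?ge0_fin_numE ?lte_fin.
move=> /embedding_dist_lt [Z [f [g [Hs BLs]]]].
exists (fun p x => mdist (f p) (g x) + s, s + s); split.
  exact: embedding_link.
by move=> _; exists s; rewrite ?s0 ?lexx//; split=> //; exists Z, f, g.
Qed.

(** Gluing all the [X_ n] to [X].  For the limit of the integrals, [eta] and then
    [d], [L] and [Q] are fixed from [h] and the mass of [X] alone, before the
    index is taken large. *)
Lemma dist_BL_embedded_cvg (X_ : nat -> mcms R) (X : mcms R) :
  dist_BL k (X_ n) X @[n --> \oo] --> 0%E -> embedded_cvg X_ X.
Proof.
move=> /cvge0P-/(_ (fun n => embedding_dist_ge0 _ _ _)) Dcvg.
pose ex n := @link_exists (X_ n) X n.+1%:R^-1 (ltac:(by rewrite invr_gt0)).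
pose c n := (sval (cid (ex n))).1.
pose slk n := (sval (cid (ex n))).2.
have cP n : link (c n) (slk n) by rewrite /c /slk; case: cid => ? [].
have near_small e : 0 < e -> \forall n \near \oo,
    exists2 s, 0 < s < e & slk n = s + s /\ realized (c n) s.
  move=> e0; have e20 : 0 < e / 2 by lra.
  have inv_near : \forall n \near \oo, n.+1%:R^-1 < e / 2.
    exact: near_infty_natSinv_lt (PosNum e20).
  apply: filterS2 (Dcvg _ e20) inv_near => n Dn invn.
  have Dfin : (dist_BL k (X_ n) X < +oo)%E by exact: lt_trans Dn (ltry _).
  rewrite /c /slk; case: cid => cs [_ /(_ Dfin)] /= [s /andP[s0 sle] sP].
  exists s => //; rewrite s0 (le_lt_trans sle)//.
  have : fine (dist_BL k (X_ n) X) < e / 2.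
    by rewrite -lte_fin fineK// ge0_fin_numE// embedding_dist_ge0.
  by move=> h; rewrite [ltRHS](splitr e) ltrD.
have slk_cvg : slk n @[n --> \oo] --> 0.
  apply/cvgrPdist_lt => e e0; have e20 : 0 < e / 2 by lra.
  apply: filterS (near_small _ e20) => n [s /andP[s0 se] [-> _]].
  by rewrite sub0r normrN gtr0_norm; lra.
pose G := Gluing cP slk_cvg.
pose f_ n : isometric_embedding (X_ n) (glued G) :=
  IsometricEmbedding (@in_piece_isometric R G (Some n)).
pose f : isometric_embedding X (glued G) :=
  IsometricEmbedding (@in_piece_isometric R G None).
have f_f n p x : mdist (f_ n p) (f x) <= c n p x.
  exact: (@mdist_hub R G (@in_piece R G (Some n) p) x).
exists (glued G), f_, f; split.
  apply/cvge0P => [n|e e0]; first exact: hausdorff_dist_ge0.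
  have e20 : 0 < e / 2 by lra.
  have [e40 e42] : 0 < e / 4 /\ e / 4 < e / 2 by split; lra.
  apply: filterS (near_small _ e40) => n [s /andP[s0 se] [sE _]].
  apply: (@le_lt_trans _ _ (e / 2)%:E); last by rewrite lte_fin; lra.
  apply: hausdorff_dist_le => //.
    move=> _ [p _ <-]; have [x px] := link_nearR (cP n) p.
    exists (f x); first by exists x.
    by have := f_f n p x; lra.
  move=> _ [x _ <-]; have [p px] := link_nearL (cP n) x.
  exists (f_ n p); first by exists p.
  by have := f_f n p x; lra.
move=> h ch _; apply/cvgrPdist_lt => e e0.
have [B B0 hB] := compact_space_bounded ch.
set m := mass (mcms_measure X).
have m0 : 0 <= m by exact: mass_ge0.
(* Chosen with [Q] so that the bound of [BL_dist_transfer] is at most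
   [3 * eta * (m + 1) + s * Q], where each term gets half of [e]. *)
pose eta := e / (6 * (m + 1)).
have eta0 : 0 < eta by rewrite divr_gt0//; lra.
have [d' d'0 hd'] := compact_space_uniformly_continuous ch eta0.
pose d := d' / 2.
have d0 : 0 < d by rewrite /d; lra.
have hd x y : mdist x y < d + d -> `|h x - h y| < eta.
  by move=> xy; apply: hd'; rewrite /d in xy; lra.
pose L := 2 * B / d.
have L0 : 0 <= L by rewrite divr_ge0//; lra.
pose Q := 2 * (L * (m + 1)) + 9 * B + L.
have Lm0 : 0 <= L * (m + 1) by rewrite mulr_ge0//; lra.
have Q0 : 0 < Q by rewrite /Q; lra.
have eQ0 : 0 < e / (2 * Q) by rewrite divr_gt0//; lra.
have near_d := near_small _ d0; have near_1 := near_small _ (ltr01 : 0 < 1 :> R).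
have near_Q := near_small _ eQ0.
near=> n.
have [s /andP[s0 sd] [sE [Z [f' [g' [cE Hs BLs]]]]]] : exists2 s, 0 < s < d &
    slk n = s + s /\ realized (c n) s by near: n.
have s1 : s < 1.
  have [s' /andP[_ s1] [sE' _]] : exists2 s, 0 < s < 1 &
    slk n = s + s /\ realized (c n) s by near: n.
  lra.
have sQ : s * Q < e / 2.
  have [s' /andP[_ sQ] [sE' _]] : exists2 s, 0 < s < e / (2 * Q) &
    slk n = s + s /\ realized (c n) s by near: n.
  rewrite -ltr_pdivlMr// (_ : e / 2 / Q = e / (2 * Q)); first lra.
  by rewrite invfM mulrA.
(* Near points in [Z] are near in [M], since the bridge adds just [s]. *)
have close p : exists2 x, mdist (f' p) (g' x) < s & mdist (f_ n p) (f x) < d + d.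
  have [fg _] := hausdorff_dist_lt Hs.
  have [|_ [x _ <-] px] := fg (f' p); first by exists p.
  by exists x => //; have := f_f n p x; rewrite cE; lra.
have sd' : 0 < s < d by rewrite s0.
have BLs' := ltW BLs.
have := BL_dist_transfer k01 ch B0 hB d0 hd sd' close BLs' (erefl L).
set mn := mass _; rewrite -/m => bound.
rewrite distrC; apply: (le_lt_trans bound).
have mn0 : 0 <= mn by exact: mass_ge0.
have mn_le : mn <= m + 1.
  have := mass_BL_dist BLs'; rewrite !mass_image -/m -/mn ler_norml => /andP[_].
  by lra.
have Ls0 : 0 <= L * s by rewrite mulr_ge0// ltW.
have b1 : (2 * eta + L * s) * mn <= (2 * eta + L * s) * (m + 1).
  by rewrite ler_wpM2l//; lra.
have b2 : (eta + L * s) * m <= (eta + L * s) * (m + 1).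
  by rewrite ler_wpM2l//; lra.
have b3 : 3 * eta * (m + 1) = e / 2.
  by rewrite /eta; field; rewrite gt_eqF//; lra.
have b4 : (2 * eta + L * s) * (m + 1) + (9 * B + L) * s + (eta + L * s) * (m + 1)
  = 3 * eta * (m + 1) + s * Q by rewrite /Q; ring.
lra.
Unshelve. all: by end_near. Qed.

End embedded_convergence.

Section topologies.
Context (R : realType) (k : R).
Hypothesis k01 : 0 < k <= 1.

Lemma dist_BL_GHP (X : mcms R) (e : R) : 0 < e -> exists2 d, 0 < d &
  forall Y : mcms R, (dist_BL k X Y < d%:E)%E -> (dist_GHP X Y < e%:E)%E.
Proof.
move=> e0; pose e2 := e / 2; have e20 : 0 < e2 by rewrite /e2; lra.
have e2i0 : 0 < e2^-1 by rewrite invr_gt0.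
have d0 : 0 < e2 / (3 + e2^-1) by rewrite divr_gt0//; lra.
exists (Num.min e2 (e2 / (3 + e2^-1))); first by rewrite lt_min e20.
move=> Y /embedding_dist_lt [Z [f [g [H BL]]]].
apply: (@le_lt_trans _ _ e2%:E); last by rewrite lte_fin /e2; lra.
have BL' : (BL_dist k (image_measure (mcms_measure X) f)
    (image_measure (mcms_measure Y) g) <= (e2 / (3 + e2^-1))%:E)%E.
  by apply: (le_trans (ltW BL)); rewrite lee_fin ge_min lexx orbT.
apply: embedding_dist_le (f) (g) _ _.
  by apply: (le_trans (ltW H)); rewrite lee_fin ge_min lexx.
apply: prokhorov_dist_le => //; try exact: image_measure_finite.
- by apply: prokhorov_close_BL BL' => //; exact: image_measure_finite.
- rewrite BL_distC in BL'.
  by apply: prokhorov_close_BL BL' => //; exact: image_measure_finite.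
Qed.

Lemma dist_GHP_BL (X : mcms R) (e : R) : 0 < e -> exists2 d, 0 < d &
  forall Y : mcms R, (dist_GHP X Y < d%:E)%E -> (dist_BL k X Y < e%:E)%E.
Proof.
move=> e0; set m := mass (mcms_measure X); have m0 : 0 <= m by exact: mass_ge0.
have k0 : 0 < k by case/andP: k01.
have [N Npos NP] : exists2 N : nat, (0 < N)%N & 4 * (2 * m + 1) / e < N%:R.
  by exists (Num.truncn (4 * (2 * m + 1) / e)).+1 => //; exact: truncnS_gt.
have N0 : 0 < N%:R^-1 :> R by rewrite invr_gt0 ltr0n.
have Ne : N%:R^-1 * (2 * m + 1) <= e / 4.
  move: NP; rewrite ltr_pdivrMr// => h; rewrite mulrC ler_pdivrMr ?ltr0n//; lra.
(* [N] makes the mass term at most [e / 4], and [3 * d] is at most [e / 4]. *)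
pose d := Num.min (N%:R^-1 `^ k^-1) (Num.min 1 (e / 12)).
have d0 : 0 < d by rewrite !lt_min powR_gt0// ltr01 /= divr_gt0.
have dk : d `^ k <= N%:R^-1.
  have -> : N%:R^-1 = (N%:R^-1 `^ k^-1) `^ k :> R.
    by rewrite -powRrM mulVf ?gt_eqF// powRr1// ltW.
  apply: ge0_ler_powR; rewrite ?nnegrE ?powR_ge0 ?(ltW k0) ?(ltW d0)//.
  by rewrite ge_min lexx.
have d1 : d <= 1 by rewrite /d !ge_min lexx ?orbT.
have de : d <= e / 12 by rewrite /d !ge_min lexx ?orbT.
exists d => // Y /embedding_dist_lt [Z [f [g [H P]]]].
apply: (@le_lt_trans _ _ (e / 2)%:E); last by rewrite lte_fin; lra.
apply: embedding_dist_le (f) (g) _ _.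
  by apply: (le_trans (ltW H)); rewrite lee_fin; lra.
have := BL_dist_le_prokhorov k01 (image_measure_finite f)
  (image_measure_finite g) Npos d0 dk P.
move=> /le_trans; apply; rewrite lee_fin mass_image -/m.
have : N%:R^-1 * (2 * m + d) <= N%:R^-1 * (2 * m + 1) by rewrite ler_pM2l//; lra.
lra.
Qed.

(** Both topologies are described by balls, so comparing balls with the same
    centre is enough. *)
Lemma induced_topologyS (K : mcms R -> Prop) (d d' : mcms R -> mcms R -> \bar R)
    (U : mcms R -> Prop) :
  (forall X (e : R), 0 < e -> exists2 r, 0 < r &
    forall Y, (d' X Y < r%:E)%E -> (d X Y < e%:E)%E) ->
  induced_topology K d U -> induced_topology K d' U.
Proof.
move=> dd' [UK UP]; split=> // X /UP [e [e0 eP]].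
have [r r0 rP] := dd' X e e0; exists r; split=> // Y KY /rP; exact: eP.
Qed.

End topologies.

Theorem theorem2p25 (R : realType) (kappa : R) (K : mcms R -> Prop) :
  0 < kappa <= 1 -> is_representative_set K ->
  (forall (X_ : nat -> mcms R) (X : mcms R), (forall n, K (X_ n)) -> K X ->
     embedded_cvg X_ X <-> dist_BL kappa (X_ n) X @[n --> \oo] --> 0%E) /\
  induced_topology K (dist_BL kappa) = induced_topology K (@dist_GHP R).
Proof.
move=> k01 _; split=> [X_ X _ _|].
  split; first exact: embedded_cvg_dist_BL.
  exact: dist_BL_embedded_cvg.
apply/funext => U; apply/propext; split; apply: induced_topologyS => X e.
  exact: dist_GHP_BL.
exact: dist_BL_GHP.
Qed.
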